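(* Let $f:SG'\times SG''\to\mathbb{R}$ be the fractal interpolation function determined by a data set $\{(y,z_y):y\in V_N\}$ and functions $\alpha_{\omega\eta},h_{\omega\eta}$ ($\omega,\eta\in I^N$), as described in the context. Let $h_{\omega\eta}$ and $\alpha_{\omega\eta}$ ($\omega,\eta\in I^N$) be Hölder continuous functions with constants $K_h$, $K_\alpha$ and Hölder exponents $s_h$, $s_{\alpha_{\omega\eta}}$ respectively. Put $a=\frac1{2^N}$, $\|\alpha\|_\infty=\max\{\|\alpha_{\omega\eta}\|_\infty:\omega,\eta\in I^N\}$, $s_\alpha=\min\{s_{\alpha_{\omega\eta}}:\omega,\eta\in I^N\}$ and $s=\min\{s_h,s_\alpha\}$. Then: (1) If $\|\alpha\|_\infty<\frac1{2^N}$, then $f$ is Hölder continuous with exponent $s$. (2) If $\|\alpha\|_\infty=\frac1{2^N}$, then $f$ is Hölder continuous with exponent $s-\mu$ for some $0<\mu<1$. (3) If $\|\alpha\|_\infty>\frac1{2^N}$, then $f$ is Hölder continuous with exponent $\lambda$, where $0<\lambda\le s-1+\frac{\ln\|\alpha\|_\infty}{\ln a}<1$.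
   Context: Let $I=\{1,2,3\}$ and $N\ge1$. Let $U_0=\{p_1,p_2,p_3\}$ be the vertices of an equilateral triangle in $\mathbb{R}^2$ and $L_i(t)=\frac12(t+p_i)$, $i\in I$; let $W_0=\{q_1,q_2,q_3\}$ be the vertices of an equilateral triangle in another copy of $\mathbb{R}^2$ and $K_i(s)=\frac12(s+q_i)$, $i\in I$. $SG'$ and $SG''$ are the Sierpiński gaskets, i.e. the unique nonempty compact sets with $SG'=\bigcup_{i\in I}L_i(SG')$ and $SG''=\bigcup_{i\in I}K_i(SG'')$. It is assumed that $\|(t,s)-(t',s')\|_2\le1$ for all $(t,s),(t',s')\in SG'\times SG''$. For a word $\omega=\omega_1\omega_2\cdots\omega_N\in I^N$ put $L_\omega=L_{\omega_1}\circ\cdots\circ L_{\omega_N}$ and $K_\omega=K_{\omega_1}\circ\cdots\circ K_{\omega_N}$. Put $V_N=\{(L_\omega(p_i),K_\eta(q_j)):\omega,\eta\in I^N,\ i,j\in I\}$. $\|\cdot\|_\infty$ is the sup norm on $SG'\times SG''$. Data and parameters: real numbers $z_y$ ($y\in V_N$) that are zero on the boundary $(U_0\times SG'')\cup(SG'\times W_0)$; continuous functions $\alpha_{\omega\eta}:SG'\times SG''\to\mathbb{R}$ with $\|\alpha_{\omega\eta}\|_\infty<1$; functions $h_{\omega\eta}:SG'\times SG''\to\mathbb{R}$ such that (M1) for $\omega=\omega_1\omega_2\cdots\omega_{N-1}i$ and $\tau=\omega_1\omega_2\cdots\omega_{N-1}j$, $h_{\omega\eta}(p_j,s)=h_{\tau\eta}(p_i,s)$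 for all $s\in SG''$; (M2) for $\eta=\eta_1\eta_2\cdots\eta_{N-1}i$ and $\xi=\eta_1\eta_2\cdots\eta_{N-1}j$, $h_{\omega\eta}(t,q_j)=h_{\omega\xi}(t,q_i)$ for all $t\in SG'$; (M3) for $\omega=\omega_1\cdots\omega_{N-1}i$, $\tau=\omega_1\cdots\omega_{N-1}j$, $\eta=\eta_1\cdots\eta_{N-1}k$ and $\xi=\eta_1\cdots\eta_{N-1}l$, $h_{\omega\eta}(p_j,q_l)=h_{\tau\xi}(p_i,q_k)$, for all $i,j,k,l\in I$. The fractal interpolation function $f$ is the continuous function $f:SG'\times SG''\to\mathbb{R}$ with $f(y)=z_y$ for all $y\in V_N$ whose graph is the attractor (unique nonempty compact invariant set) of the system of maps $W_{\omega\eta}(t,s,x)=(L_\omega(t),K_\eta(s),\alpha_{\omega\eta}(t,s)x+h_{\omega\eta}(t,s))$, $\omega,\eta\in I^N$, on $SG'\times SG''\times\mathbb{R}$. It satisfies $f(L_\omega(t),K_\eta(s))=\alpha_{\omega\eta}(t,s)f(t,s)+h_{\omega\eta}(t,s)$ for all $(t,s)\in SG'\times SG''$ and $\omega,\eta\in I^N$. A function $g:SG'\times SG''\to\mathbb{R}$ is Hölder continuous with constant $C$ and exponent $\beta$ if $|g(t,s)-g(t',s')|\le C\|(t,s)-(t',s')\|_2^{\beta}$ for all distinct points $(t,s),(t',s')$ (Hölder with exponent $\beta$ if this holds for some $C$). The exponents $s_h$, $s_{\alpha_{\omega\eta}}$ in the hypotheses are in $(0,1]$. In the exponents of the conclusions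 the letter $s$ denotes the number $\min\{s_h,s_\alpha\}$, not a point of $SG''$. *)

(* Defs.v *)
From HB Require Import structures.
From mathcomp Require Export all_boot all_order all_algebra.
From mathcomp Require Export all_classical all_reals all_analysis.
Export Order.TTheory GRing.Theory Num.Theory numFieldNormedType.Exports.

Set Implicit Arguments.
Unset Strict Implicit.
Unset Printing Implicit Defensive.

Local Open Scope classical_set_scope.
Local Open Scope ring_scope.

(* The library norm on row vectors and on pairs is the sup norm; it gives the
   usual topology, but the Euclidean distance has to be defined separately. *)
Definition edist2 (R : realType) (x y : 'rV[R]_2) : R :=
  Num.sqrt (\sum_(i < 2) (x 0 i - y 0 i) ^+ 2).

Definition edist4 (R : realType) (x y : 'rV[R]_2 * 'rV[R]_2) : R :=
  Num.sqrt (\sum_(i < 2) (x.1 0 i - y.1 0 i) ^+ 2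
            + \sum_(i < 2) (x.2 0 i - y.2 0 i) ^+ 2).

Definition equilateral (R : realType) (p : 'I_3 -> 'rV[R]_2) : Prop :=
  exists2 l : R, 0 < l & forall i j, i != j -> edist2 (p i) (p j) = l.

(* [A] is the unique nonempty compact subset of [X] invariant under the
   system [w].  The maps are total, but only their values on [X] matter. *)
Definition invariant_compact (T : topologicalType) (J : Type)
    (X : set T) (w : J -> T -> T) (A : set T) : Prop :=
  [/\ A `<=` X, A !=set0, compact A & A = \bigcup_(j in setT) (w j @` A)].

Definition attractor (T : topologicalType) (J : Type)
    (X : set T) (w : J -> T -> T) (A : set T) : Prop :=
  invariant_compact X w A /\ forall B, invariant_compact X w B -> B = A.

Definition half_map (R : realType) (p : 'I_3 -> 'rV[R]_2) (i : 'I_3)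
  (t : 'rV[R]_2) : 'rV[R]_2 := 2^-1 *: (t + p i).

Definition is_gasket (R : realType) (p : 'I_3 -> 'rV[R]_2)
    (SG : set 'rV[R]_2) : Prop :=
  equilateral p /\ attractor setT (half_map p) SG.

Definition word (N : nat) := N.-tuple 'I_3.

(* [word_map p [:: w1; ...; wN]] is L_w1 \o ... \o L_wN. *)
Definition word_map (R : realType) (p : 'I_3 -> 'rV[R]_2) (w : seq 'I_3) :
    'rV[R]_2 -> 'rV[R]_2 :=
  foldr (fun i g => half_map p i \o g) idfun w.

Definition vertices (R : realType) (p q : 'I_3 -> 'rV[R]_2) (N : nat) :
    set ('rV[R]_2 * 'rV[R]_2) :=
  [set y | exists (w e : word N) (i j : 'I_3),
     y = (word_map p w (p i), word_map q e (q j))].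

Definition supnorm (R : realType) (T : Type) (D : set T) (g : T -> R) : R :=
  sup [set `|g x| | x in D].

Definition holder_with (R : realType) (D : set ('rV[R]_2 * 'rV[R]_2))
    (g : 'rV[R]_2 * 'rV[R]_2 -> R) (C b : R) : Prop :=
  forall x y, D x -> D y -> x <> y -> `|g x - g y| <= C * edist4 x y `^ b.

Definition holder (R : realType) (D : set ('rV[R]_2 * 'rV[R]_2))
    (g : 'rV[R]_2 * 'rV[R]_2 -> R) (b : R) : Prop :=
  exists C, holder_with D g C b.

(* In these three conditions, the last letters of the words are the ones that
   are exchanged; [u] and [v] are the common prefixes of length N - 1. *)
Definition matching1 (R : realType) (N : nat) (p : 'I_3 -> 'rV[R]_2)
    (SG2 : set 'rV[R]_2)
    (h : word N -> word N -> 'rV[R]_2 * 'rV[R]_2 -> R) : Prop :=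
  forall (w t e : word N) (u : seq 'I_3) (i j : 'I_3),
    w = rcons u i :> seq 'I_3 -> t = rcons u j :> seq 'I_3 ->
    forall s, SG2 s -> h w e (p j, s) = h t e (p i, s).

Definition matching2 (R : realType) (N : nat) (q : 'I_3 -> 'rV[R]_2)
    (SG1 : set 'rV[R]_2)
    (h : word N -> word N -> 'rV[R]_2 * 'rV[R]_2 -> R) : Prop :=
  forall (w e x : word N) (v : seq 'I_3) (i j : 'I_3),
    e = rcons v i :> seq 'I_3 -> x = rcons v j :> seq 'I_3 ->
    forall t, SG1 t -> h w e (t, q j) = h w x (t, q i).

Definition matching3 (R : realType) (N : nat) (p q : 'I_3 -> 'rV[R]_2)
    (h : word N -> word N -> 'rV[R]_2 * 'rV[R]_2 -> R) : Prop :=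
  forall (w t e x : word N) (u v : seq 'I_3) (i j k l : 'I_3),
    w = rcons u i :> seq 'I_3 -> t = rcons u j :> seq 'I_3 ->
    e = rcons v k :> seq 'I_3 -> x = rcons v l :> seq 'I_3 ->
    h w e (p j, q l) = h t x (p i, q k).

Definition fif_map (R : realType) (N : nat) (p q : 'I_3 -> 'rV[R]_2)
    (alpha h : word N -> word N -> 'rV[R]_2 * 'rV[R]_2 -> R)
    (we : word N * word N) (y : 'rV[R]_2 * 'rV[R]_2 * R) :
    'rV[R]_2 * 'rV[R]_2 * R :=
  ((word_map p we.1 y.1.1, word_map q we.2 y.1.2),
   alpha we.1 we.2 y.1 * y.2 + h we.1 we.2 y.1).

Definition is_fif (R : realType) (N : nat) (p q : 'I_3 -> 'rV[R]_2)
    (SG1 SG2 : set 'rV[R]_2) (z : 'rV[R]_2 * 'rV[R]_2 -> R)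
    (alpha h : word N -> word N -> 'rV[R]_2 * 'rV[R]_2 -> R)
    (f : 'rV[R]_2 * 'rV[R]_2 -> R) : Prop :=
  [/\ {within SG1 `*` SG2, continuous f},
      forall y, vertices p q N y -> f y = z y
    & attractor ((SG1 `*` SG2) `*` [set: R]) (fif_map p q alpha h)
        [set y | (SG1 `*` SG2) y.1 /\ y.2 = f y.1]].

(* The default value 0 is harmless because norms are nonnegative, and the
   default value 1 because the exponents are at most 1. *)
Definition max_supnorm (R : realType) (T : Type) (N : nat) (D : set T)
    (alpha : word N -> word N -> T -> R) : R :=
  \big[Num.max/0]_(we : word N * word N) supnorm D (alpha we.1 we.2).

Definition min_exponent (R : realType) (N : nat)
    (sa : word N -> word N -> R) : R :=
  \big[Num.min/1]_(we : word N * word N) sa we.1 we.2.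

(* Main.v *)
(* Let E_n be the largest oscillation of f over the cells
   L_w(SG') x K_e(SG''), w and e of length n N.  The functional equation gives
   E_(n+1) <= kappa E_n + C rho^n for rho = a^s and every
   kappa >= ||alpha||, hence E_n = O(r^n) as soon as kappa <> rho and both are
   at most r.  Two points at distance less than a constant times a^n lie in
   level-n cells that share a point, so |f x - f y| <= 2 E_n, and f is Hoelder
   with exponent beta when r = a^beta.  The three cases are
   kappa = ||alpha||, r = rho; kappa = r = a^(s/2); kappa = r = a^lambda. *)
From mathcomp Require Import ring lra.
Require Import Defs.

Set Implicit Arguments.
Unset Strict Implicit.
Unset Printing Implicit Defensive.

Local Open Scope classical_set_scope.
Local Open Scope ring_scope.

(** * Contraction maps and Euclidean distances *)

Lemma half_mapB (R : realType) (p : 'I_3 -> 'rV[R]_2) i (x y : 'rV[R]_2) :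
  half_map p i x - half_map p i y = 2^-1 *: (x - y).
Proof. by rewrite /half_map -scalerBr opprD addrACA subrr addr0. Qed.

Lemma half_map_fixed (R : realType) (p : 'I_3 -> 'rV[R]_2) i :
  half_map p i (p i) = p i.
Proof. by apply/rowP => k; rewrite !mxE; field. Qed.

Lemma word_mapB (R : realType) (p : 'I_3 -> 'rV[R]_2) w (x y : 'rV[R]_2) :
  word_map p w x - word_map p w y = 2^-1 ^+ size w *: (x - y).
Proof.
elim: w => [|i w IH] /=; first by rewrite expr0 scale1r.
by rewrite half_mapB IH scalerA exprS.
Qed.

Lemma word_map_cat (R : realType) (p : 'I_3 -> 'rV[R]_2) v w x :
  word_map p (v ++ w) x = word_map p v (word_map p w x).
Proof. by elim: v => //= i v ->. Qed.

Lemma word_map_nseq (R : realType) (p : 'I_3 -> 'rV[R]_2) m j :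
  word_map p (nseq m j) (p j) = p j.
Proof. by elim: m => //= m ->; rewrite half_map_fixed. Qed.

Lemma edist2_scale (R : realType) (c : R) (x y x' y' : 'rV[R]_2) : 0 <= c ->
  x' - y' = c *: (x - y) -> edist2 x' y' = c * edist2 x y.
Proof.
move=> c0 E; rewrite /edist2.
under eq_bigr => i _.
  have := congr1 (fun v : 'rV[R]_2 => v 0 i) E; rewrite !mxE => ->.
  rewrite exprMn; over.
by rewrite -mulr_sumr sqrtrM ?sqr_ge0// sqrtr_sqr ger0_norm.
Qed.

Lemma edist4_scale (R : realType) (c : R) (x y x' y' : 'rV[R]_2 * 'rV[R]_2) :
  0 <= c -> x'.1 - y'.1 = c *: (x.1 - y.1) -> x'.2 - y'.2 = c *: (x.2 - y.2) ->
  edist4 x' y' = c * edist4 x y.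
Proof.
move=> c0 E1 E2; rewrite /edist4.
under eq_bigr => i _.
  have := congr1 (fun v : 'rV[R]_2 => v 0 i) E1; rewrite !mxE => ->.
  rewrite exprMn; over.
under [X in _ + X]eq_bigr => i _.
  have := congr1 (fun v : 'rV[R]_2 => v 0 i) E2; rewrite !mxE => ->.
  rewrite exprMn; over.
by rewrite -!mulr_sumr -mulrDr sqrtrM ?sqr_ge0// sqrtr_sqr ger0_norm.
Qed.

Lemma edist2_le_edist4 (R : realType) (x y : 'rV[R]_2 * 'rV[R]_2) :
  edist2 x.1 y.1 <= edist4 x y /\ edist2 x.2 y.2 <= edist4 x y.
Proof.
have S (u v : 'rV[R]_2) : 0 <= \sum_(i < 2) (u 0 i - v 0 i) ^+ 2.
  by apply: sumr_ge0 => i _; rewrite sqr_ge0.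
by split; rewrite ler_wsqrtr// ?lerDl ?lerDr.
Qed.

Lemma edist4_gt0 (R : realType) (x y : 'rV[R]_2 * 'rV[R]_2) :
  x <> y -> 0 < edist4 x y.
Proof.
move=> xy; rewrite lt_neqAle sqrtr_ge0 andbT; apply/eqP => E; apply: xy.
have S (u v : 'rV[R]_2) : 0 <= edist2 u v by rewrite sqrtr_ge0.
have Z (u v : 'rV[R]_2) : edist2 u v <= 0 -> u = v.
  rewrite -sqrtr0 ler_sqrt// => le0; apply/rowP => i.
  have /eqP : \sum_(i < 2) (u 0 i - v 0 i) ^+ 2 == 0.
    by rewrite eq_le le0 sumr_ge0// => k _; rewrite sqr_ge0.
  move/psumr_eq0P => /(_ (fun k _ => sqr_ge0 _))/(_ i isT)/eqP.
  by rewrite sqrf_eq0 subr_eq0 => /eqP.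
have [] := edist2_le_edist4 x y; rewrite -E => /Z e1 /Z e2.
by case: x y e1 e2 {E} => [a b] [c d] /= -> ->.
Qed.

(** * Self-similarity of the gasket *)

Lemma half_map_closed (R : realType) (p : 'I_3 -> 'rV[R]_2) SG i t :
  is_gasket p SG -> SG t -> SG (half_map p i t).
Proof.
case=> _ [] [_ _ _ E] _ St; rewrite E.
by exists i => //; exists t.
Qed.

Lemma word_map_closed (R : realType) (p : 'I_3 -> 'rV[R]_2) SG w t :
  is_gasket p SG -> SG t -> SG (word_map p w t).
Proof. by move=> G St; elim: w => //= i w /half_map_closed; exact. Qed.

Lemma half_map_cover (R : realType) (p : 'I_3 -> 'rV[R]_2) SG t :
  is_gasket p SG -> SG t -> exists i u, SG u /\ t = half_map p i u.
Proof.
case=> _ [] [_ _ _ E] _; rewrite {1}E => -[i _ [u Su <-]].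
by exists i, u.
Qed.

(** [p j] is the fixed point of [half_map p j], hence the limit of the iterates of that map from any
    point of the gasket, which is closed. *)
Lemma vertex_in_gasket (R : realType) (p : 'I_3 -> 'rV[R]_2) SG j :
  is_gasket p SG -> SG (p j).
Proof.
move=> G; have [_ [] [_ [t St] cSG _] _] := G.
have clSG : closed SG by apply: compact_closed => //; exact: norm_hausdorff.
apply: (@closed_cvg _ _ \oo _ (fun m => word_map p (nseq m j) t) SG clSG).
  by apply: nearW => m; exact: word_map_closed.
rewrite [X in X @ _ --> _](_ : _ = fun m => 2^-1 ^+ m *: (t - p j) + p j).
  rewrite -[X in _ --> X]add0r; apply: cvgD; last exact: cvg_cst.
  rewrite -(scale0r (t - p j)); apply: cvgZr_tmp; apply: cvg_expr.
  by rewrite ger0_norm ?invr_ge0// invf_lt1// ltr1n.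
by apply/funext => m; rewrite -[in LHS](subrK (word_map p (nseq m j) (p j))
  (word_map _ _ t)) word_mapB size_nseq word_map_nseq.
Qed.

(** * Barycentric coordinates on the gasket *)

(* The quadratic terms cancel, so [bary p l k] is an affine function; it is
   1 at [p k] and 0 at the other two vertices of a triangle of side [l]. *)
Definition bary (R : realType) (p : 'I_3 -> 'rV[R]_2) (l : R) (k : 'I_3)
    (t : 'rV[R]_2) : R :=
  (\sum_(j < 3) edist2 t (p j) ^+ 2 - 3 * edist2 t (p k) ^+ 2 + l ^+ 2)
  / (3 * l ^+ 2).

Lemma sqr_edist2 (R : realType) (x y : 'rV[R]_2) :
  edist2 x y ^+ 2 = (x 0 0 - y 0 0) ^+ 2 + (x 0 1 - y 0 1) ^+ 2.
Proof.
rewrite /edist2 big_ord_recl big_ord1 sqr_sqrtr ?addr_ge0 ?sqr_ge0//.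
by rewrite (_ : lift ord0 ord0 = 1)//; apply/val_inj.
Qed.

Lemma bary_vertex (R : realType) (p : 'I_3 -> 'rV[R]_2) (l : R) k i : 0 < l ->
  (forall i j, i != j -> edist2 (p i) (p j) = l) ->
  bary p l k (p i) = (i == k)%:R.
Proof.
move=> l0 pl.
have d m n : edist2 (p m) (p n) ^+ 2 = (m != n)%:R * l ^+ 2.
  case: eqVneq => [->|/pl ->]; last by rewrite mul1r.
  by rewrite sqr_edist2 !subrr !expr0n mul0r addr0.
rewrite /bary (eq_bigr _ (fun j _ => d i j)) d -mulr_suml.
have -> : \sum_(j < 3) (i != j)%:R = 2 :> R.
  rewrite (bigD1 i)//= eqxx add0r.
  rewrite (eq_bigr (fun=> 1)) => [|j]; last by rewrite eq_sym => ->.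
  by rewrite sumr_const cardC1 card_ord.
have lN0 : l != 0 by rewrite gt_eqF.
by case: eqVneq => _ /=; field.
Qed.

(** [half_map p i t] is the midpoint of [t] and [p i], and an affine function takes the mean value
    at a midpoint. *)
Lemma bary_half_map (R : realType) (p : 'I_3 -> 'rV[R]_2) (l : R) k i t :
  0 < l -> (forall i j, i != j -> edist2 (p i) (p j) = l) ->
  bary p l k (half_map p i t) = (bary p l k t + (i == k)%:R) / 2.
Proof.
move=> l0 pl; rewrite -(bary_vertex k i l0 pl) /bary !big_ord_recl !big_ord0.
rewrite !sqr_edist2 !mxE.
have lN0 : l != 0 by rewrite gt_eqF.
by field.
Qed.

Lemma coord_le_edist2 (R : realType) (x y : 'rV[R]_2) :
  `|x 0 0 - y 0 0| <= edist2 x y /\ `|x 0 1 - y 0 1| <= edist2 x y.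
Proof.
have d0 : 0 <= edist2 x y by rewrite sqrtr_ge0.
by split; rewrite -(ler_pXn2r (n := 2))// ?nnegrE// real_normK ?num_real//
  sqr_edist2 ?lerDl ?lerDr ?sqr_ge0.
Qed.

Lemma bary_lipschitz (R : realType) (p : 'I_3 -> 'rV[R]_2) (l : R) : 0 < l ->
  exists2 L : R, 0 < L &
    forall k t t', `|bary p l k t - bary p l k t'| <= L * edist2 t t'.
Proof.
move=> l0.
have lN0 : l != 0 by rewrite gt_eqF.
(* [c k] is the gradient of [bary p l k]. Summing over all [k] gives one constant for the three
   coordinates, and adding 1 makes it positive. *)
pose c k i := (2 / (3 * l ^+ 2)) * (3 * p k 0 i - \sum_(j < 3) p j 0 i).
have S0 (P : pred 'I_3) : 0 <= \sum_(k | P k) (`|c k 0| + `|c k 1|).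
  by apply: sumr_ge0 => k _; rewrite addr_ge0.
exists (\sum_k (`|c k 0| + `|c k 1|) + 1); first by rewrite ltr_wpDl.
move=> k t t'.
have -> : bary p l k t - bary p l k t' =
    c k 0 * (t 0 0 - t' 0 0) + c k 1 * (t 0 1 - t' 0 1).
  rewrite /bary /c !big_ord_recl !big_ord0 !sqr_edist2; field.
  by [].
have [d1 d2] := coord_le_edist2 t t'.
apply: (le_trans (ler_normD _ _)); rewrite ![`|c _ _ * _|]normrM.
rewrite (bigD1 k)//= -addrA mulrDl ler_wpDr ?mulr_ge0 ?addr_ge0 ?sqrtr_ge0//.
by rewrite mulrDl; apply: lerD; apply: ler_wpM2l.
Qed.

(** The supremum S of [g] satisfies S <= (S + 1) / 2, so S <= 1. The bound [M] serves only to make S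
    a genuine supremum. *)
Lemma halving_le1 (R : realType) (T : Type) (A : set T) (g : T -> R) (M : R) :
  (forall t, A t -> g t <= M) ->
  (forall t, A t -> exists2 u, A u & g t <= (g u + 1) / 2) ->
  forall t, A t -> g t <= 1.
Proof.
move=> gM gA t At.
have ub : has_ubound [set g x | x in A] by exists M => _ [x Ax <-]; exact: gM.
have le_sup x : A x -> g x <= sup [set g x | x in A].
  by move=> Ax; apply: ub_le_sup => //; exists x.
have : sup [set g x | x in A] <= (sup [set g x | x in A] + 1) / 2.
  apply: ge_sup; first by exists (g t), t.
  by move=> _ [x /gA [u /le_sup gu gx] <-]; lra.
by have := le_sup _ At; lra.
Qed.

(** By self-similarity both [bary] and [1 - bary] satisfy the halving inequality; they are bounded
    because [bary] is Lipschitz and the diameter is at most 1. *)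
Lemma bary_ge0_le1 (R : realType) (p : 'I_3 -> 'rV[R]_2) SG (l : R) k t :
  0 < l -> (forall i j, i != j -> edist2 (p i) (p j) = l) ->
  is_gasket p SG -> (forall x y, SG x -> SG y -> edist2 x y <= 1) ->
  SG t -> 0 <= bary p l k t <= 1.
Proof.
move=> l0 pl G D St.
have [L L0 HL] := bary_lipschitz p l0.
have B x : SG x -> `|bary p l k x - bary p l k t| <= L.
  move=> Sx; apply: le_trans (HL k _ _) _.
  by rewrite -[leRHS]mulr1 ler_wpM2l ?D// ltW.
apply/andP; split.
  rewrite -(lerD2l 1) addr0 -lerBlDr.
  apply: (@halving_le1 _ _ SG (fun x => 1 - bary p l k x)
    (1 - bary p l k t + L)) => //.
    by move=> x /B; rewrite ler_norml => /andP[? ?]; lra.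
  move=> x /(half_map_cover G) [i [u [Su ->]]]; exists u => //.
  by rewrite bary_half_map//; case: (i == k) => /=; lra.
apply: (@halving_le1 _ _ SG (bary p l k) (bary p l k t + L)) => //.
  by move=> x /B; rewrite ler_norml => /andP[? ?]; lra.
move=> x /(half_map_cover G) [i [u [Su ->]]]; exists u => //.
by rewrite bary_half_map//; case: (i == k) => /=; lra.
Qed.

(** * Nearby points lie in touching cells *)

(** A gasket point may lie in two cells of level [m]; one suitable choice of cells suffices. The
    common point has one preimage per cell, [v] and [v']. *)
Definition touching (R : realType) (p : 'I_3 -> 'rV[R]_2) (SG : set 'rV[R]_2)
    (m : nat) (t t' : 'rV[R]_2) : Prop :=
  exists w w' u u' v v',
    [/\ size w = m /\ size w' = m, [/\ SG u, SG u', SG v & SG v'],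
        t = word_map p w u, t' = word_map p w' u'
      & word_map p w v = word_map p w' v'].

(** A first letter other than [j] would give a coordinate at most 1/2. After a first letter [j], the
    distance of the coordinate from 1 doubles when that letter is removed, and induction applies. *)
Lemma bary_near_vertex (R : realType) (p : 'I_3 -> 'rV[R]_2) SG (l : R) j m u :
  0 < l -> (forall i j, i != j -> edist2 (p i) (p j) = l) ->
  is_gasket p SG -> (forall x y, SG x -> SG y -> edist2 x y <= 1) ->
  SG u -> 1 - 2^-1 ^+ m < bary p l j u ->
  exists2 v, SG v & u = word_map p (nseq m j) v.
Proof.
move=> l0 pl G D; elim: m u => [|m IH] u Su; first by exists u.
have [i [u1 [Su1 ->]]] := half_map_cover G Su.
have := bary_ge0_le1 j l0 pl G D Su1.
have h1 : 2^-1 ^+ m <= 1 :> R by rewrite exprn_ile1 ?invr_ge0// invf_le1// ler1n.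
rewrite bary_half_map// exprS; case: eqVneq => [->|_] /= B H.
  have [|v Sv ->] := IH u1 Su1; first by lra.
  by exists v.
by exfalso; lra.
Qed.

(* Points whose first letters i <> j differ and whose distance is small are both
   close to the junction L_i(p_j) = L_j(p_i), hence lie in the cells
   L_i L_j^m and L_j L_i^m, which contain it. *)
Lemma close_touching (R : realType) (p : 'I_3 -> 'rV[R]_2) SG :
  is_gasket p SG -> (forall x y, SG x -> SG y -> edist2 x y <= 1) ->
  exists2 L : R, 0 < L & forall m t t', SG t -> SG t' ->
    (0 < m)%N ==> (L * edist2 t t' < 2^-1 ^+ m) -> touching p SG m t t'.
Proof.
move=> G D; have [[l l0 pl] _] := G.
have [L L0 HL] := bary_lipschitz p l0.
exists L => //; elim=> [|m IH] t t' St St' /= close.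
  (* The only cell of level 0 is the whole gasket, so no closeness is required there; hence the
     guard [0 < m]. *)
  by exists [::], [::], t, t', t, t.
have [i [u [Su tu]]] := half_map_cover G St.
have [j [u' [Su' tu']]] := half_map_cover G St'.
have [eij|nij] := eqVneq i j.
  have [|w [w' [v [v' [x [x' [[sw sw'] S e1 e2 e3]]]]]]] := IH u u' Su Su'.
    (* Removing the shared first letter doubles the distance, and the admissible bound doubles
       too. *)
    apply/implyP => _; move: close; rewrite tu tu' eij exprS.
    rewrite (edist2_scale (c := 2^-1) (x := u) (y := u')) ?half_mapB//.
    by rewrite mulrCA ltr_pM2l// invr_gt0.
  exists (i :: w), (i :: w'), v, v', x, x'; split => //=; last by rewrite e3.
  - by rewrite sw sw'.
  - by rewrite tu e1.
  - by rewrite tu' eij e2.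
(* Coordinate [k'] is at least 1/2 on the cell of [k'], and in the cell of [k] it is half its value
   at [x]. Closeness thus forces that value above 1 - 2^-m. *)
have near k k' x x' : k != k' -> SG x -> SG x' ->
    L * edist2 (half_map p k x) (half_map p k' x') < 2^-1 ^+ m.+1 ->
    exists2 v, SG v & x = word_map p (nseq m k') v.
  move=> nk Sx Sx' cl; apply: (bary_near_vertex l0 pl G D Sx).
  have := le_lt_trans (HL k' _ _) cl.
  have := bary_ge0_le1 k' l0 pl G D Sx'.
  rewrite ltr_norml !bary_half_map// (negbTE nk) eqxx exprS /=.
  by move=> /andP[? ?] /andP[? ?]; lra.
rewrite tu tu' in close *.
have [v Sv uv] := near i j u u' nij Su Su' close.
have [v' Sv' uv'] : exists2 v, SG v & u' = word_map p (nseq m i) v.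
  apply: (near j i u' u) => //; first by rewrite eq_sym.
  suff -> : edist2 (half_map p j u') (half_map p i u) =
    edist2 (half_map p i u) (half_map p j u') by [].
  by congr Num.sqrt; apply: eq_bigr => k _; rewrite -sqrrN opprB.
(* The tails fix [p j] and [p i], so both words lead to the midpoint of [p i] and [p j]. *)
exists (i :: nseq m j), (j :: nseq m i), v, v', (p j), (p i); split => //=.
- by rewrite !size_nseq.
- by split => //; exact: (vertex_in_gasket _ G).
- by rewrite uv.
- by rewrite uv'.
- by rewrite !word_map_nseq /half_map addrC.
Qed.


(** * A linear recursion with geometric forcing *)

Lemma powRX (R : realType) (x b : R) n : 0 <= x -> (x ^+ n) `^ b = (x `^ b) ^+ n.
Proof. by move=> x0; rewrite -!powR_mulrn ?powR_ge0// powRAC. Qed.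

Lemma geometric_recursion (R : realType) (E : nat -> R) (M C kappa rho r : R) :
  0 <= M -> 0 <= C -> 0 <= kappa <= r -> 0 <= rho <= r -> kappa != rho ->
  E 0%N <= M -> (forall n, E n.+1 <= kappa * E n + C * rho ^+ n) ->
  forall n, E n <= (M + C / `|kappa - rho|) * r ^+ n.
Proof.
move=> M0 C0 /andP[k0 kr] /andP[rho0 rhor] neq E0 ES n.
have d0 : kappa - rho != 0 by rewrite subr_eq0.
(* [F] solves the recursion with equality from the value [M]; the quotient is the closed form of the
   convolution of the powers of [kappa] and [rho]. *)
pose F n := M * kappa ^+ n + C * ((kappa ^+ n - rho ^+ n) / (kappa - rho)).
have EF m : E m <= F m.
  elim: m => [|m IH]; first by rewrite /F !expr0 subrr mul0r mulr0 addr0 mulr1.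
  apply: (le_trans (ES m)); apply: (@le_trans _ _ (kappa * F m + C * rho ^+ m)).
    by rewrite lerD2r ler_wpM2l.
  by rewrite le_eqVlt; apply/orP; left; apply/eqP; rewrite /F !exprS; field.
apply: (le_trans (EF n)); rewrite mulrDl -mulrA; apply: lerD.
  by rewrite ler_wpM2l// lerXn2r// nnegrE (le_trans k0).
(* Both powers lie between 0 and [r ^+ n], hence so does the absolute value of their difference,
   whatever the sign of [kappa - rho]. *)
rewrite ler_wpM2l//; apply: (le_trans (ler_norm _)).
rewrite normrM normfV mulrC ler_wpM2l ?invr_ge0//.
have k1 : 0 <= kappa ^+ n <= r ^+ n.
  by rewrite exprn_ge0//= lerXn2r// nnegrE (le_trans k0).
have r1 : 0 <= rho ^+ n <= r ^+ n.
  by rewrite exprn_ge0//= lerXn2r// nnegrE (le_trans k0).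
by move: k1 r1 => /andP[? ?] /andP[? ?]; rewrite ler_norml; apply/andP; split; lra.
Qed.

(** * Oscillation of the interpolation function over cells *)

Definition cell_map (R : realType) (p q : 'I_3 -> 'rV[R]_2) (w e : seq 'I_3)
    (x : 'rV[R]_2 * 'rV[R]_2) : 'rV[R]_2 * 'rV[R]_2 :=
  (word_map p w x.1, word_map q e x.2).

Lemma edist4_cell_map (R : realType) (p q : 'I_3 -> 'rV[R]_2) w e x y :
  size w = size e ->
  edist4 (cell_map p q w e x) (cell_map p q w e y)
  = 2^-1 ^+ size w * edist4 x y.
Proof.
move=> swe; apply: edist4_scale; rewrite ?exprn_ge0 ?invr_ge0//.
  exact: word_mapB.
by rewrite swe; exact: word_mapB.
Qed.

Lemma cell_map_closed (R : realType) (p q : 'I_3 -> 'rV[R]_2) SG1 SG2 w e x :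
  is_gasket p SG1 -> is_gasket q SG2 -> (SG1 `*` SG2) x ->
  (SG1 `*` SG2) (cell_map p q w e x).
Proof. by move=> G1 G2 [? ?]; split; exact: word_map_closed. Qed.

(** The graph is invariant, so [fif_map] sends [(x, f x)] back to the graph; the last coordinate of
    the image gives the equation. *)
Lemma fif_equation (R : realType) (N : nat) p q (SG1 SG2 : set 'rV[R]_2) z
    (alpha h : word N -> word N -> 'rV[R]_2 * 'rV[R]_2 -> R) f (w e : word N) x :
  is_fif p q SG1 SG2 z alpha h f -> (SG1 `*` SG2) x ->
  f (cell_map p q w e x) = alpha w e x * f x + h w e x.
Proof.
case=> _ _ [[_ _ _ E] _] Dx.
set G := [set y | _] in E.
have : G (fif_map p q alpha h (w, e) (x, f x)).
  by rewrite E; exists (w, e) => //; exists (x, f x).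
by case=> _ /= <-.
Qed.

Lemma compact_continuous_bounded (R : realType) (T : topologicalType)
    (D : set T) (g : T -> R) : compact D -> {within D, continuous g} ->
  exists2 M : R, 0 <= M & forall x, D x -> `|g x| <= M.
Proof.
move=> cD cg; have /compact_bounded[M [_ HM]] := continuous_compact cg cD.
exists (`|M| + 1) => [|x Dx]; first by rewrite addr_ge0.
apply: (HM (`|M| + 1)); last by exists x.
by rewrite (le_lt_trans (ler_norm M))// ltrDl.
Qed.

(** Distances are at most 1, so lowering the exponent increases the power. The absolute value allows
    for a negative [C] and makes the bound valid for equal points too. *)
Lemma holder_weaken (R : realType) (D : set ('rV[R]_2 * 'rV[R]_2)) g (C b b' : R) :
  (forall x y, D x -> D y -> edist4 x y <= 1) -> holder_with D g C b ->
  b' <= b -> forall x y, D x -> D y ->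
  `|g x - g y| <= `|C| * edist4 x y `^ b'.
Proof.
move=> diam H bb x y Dx Dy; have [->|/eqP xy] := eqVneq x y.
  by rewrite subrr normr0 mulr_ge0 ?powR_ge0.
apply: le_trans (H _ _ Dx Dy xy) _.
apply: (@le_trans _ _ (`|C| * edist4 x y `^ b)).
  by rewrite ler_wpM2r ?powR_ge0// ler_norm.
by rewrite ler_wpM2l// ger_powR// edist4_gt0//= diam.
Qed.

Lemma fif_level_oscillation (R : realType) (N : nat) p q
    (SG1 SG2 : set 'rV[R]_2) z
    (alpha h : word N -> word N -> 'rV[R]_2 * 'rV[R]_2 -> R) f
    (Kh Ka s kappa beta : R) :
  is_gasket p SG1 -> is_gasket q SG2 ->
  (forall x y, (SG1 `*` SG2) x -> (SG1 `*` SG2) y -> edist4 x y <= 1) ->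
  is_fif p q SG1 SG2 z alpha h f -> 0 <= s ->
  (forall w e x, (SG1 `*` SG2) x -> `|alpha w e x| <= kappa) ->
  (forall w e x y, (SG1 `*` SG2) x -> (SG1 `*` SG2) y ->
     `|h w e x - h w e y| <= `|Kh| * edist4 x y `^ s) ->
  (forall w e x y, (SG1 `*` SG2) x -> (SG1 `*` SG2) y ->
     `|alpha w e x - alpha w e y| <= `|Ka| * edist4 x y `^ s) ->
  beta <= s -> kappa <= (2^-1 ^+ N) `^ beta -> kappa != (2^-1 ^+ N) `^ s ->
  exists2 B, 0 <= B & forall n w e x y,
    size w = (n * N)%N -> size e = (n * N)%N ->
    (SG1 `*` SG2) x -> (SG1 `*` SG2) y ->
    `|f (cell_map p q w e x) - f (cell_map p q w e y)|
      <= B * ((2^-1 ^+ N) `^ beta) ^+ n.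
Proof.
move=> G1 G2 diam hf s0 ak hK aK bs kr kN.
set a : R := 2^-1 ^+ N in kr kN *; set D := SG1 `*` SG2 in diam ak hK aK *.
have a01 : 0 < a <= 1.
  by rewrite exprn_gt0 ?invr_gt0//= exprn_ile1 ?invr_ge0// invf_le1// ler1n.
have [M M0 fM] : exists2 M : R, 0 <= M & forall x, D x -> `|f x| <= M.
  apply: compact_continuous_bounded; last by case: hf.
  by apply: compact_setX; [case: G1 => _ [] [] | case: G2 => _ [] []].
have kappa0 : 0 <= kappa.
  have [_ [] [_ [t1 S1] _ _] _] := G1; have [_ [] [_ [t2 S2] _ _] _] := G2.
  have w : word N by exact: [tuple of nseq N ord0].
  exact: le_trans (ak w w (t1, t2) (conj S1 S2)).
(* [C] collects the oscillation of [h] and that of [alpha] multiplied by the bound on [f]. *)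
pose C : R := `|Kh| + `|Ka| * M.
have C0 : 0 <= C by rewrite addr_ge0 ?mulr_ge0.
pose osc n (w e : seq 'I_3) x y := [/\ size w = (n * N)%N, size e = (n * N)%N, D x & D y].
(* [V n] consists of the increments of [f] inside level-[n] cells; it is bounded and nonempty, so
   its [sup] is the E_n of the recursion. *)
pose V n : set R := [set `|f (cell_map p q u.1.1 u.1.2 u.2.1)
                  - f (cell_map p q u.1.1 u.1.2 u.2.2)| | u in
             [set u | osc n u.1.1 u.1.2 u.2.1 u.2.2]].
have cD w e x : D x -> D (cell_map p q w e x) by exact: cell_map_closed.
have V2M n : ubound (V n) (2 * M).
  move=> _ [[[w e] [x y]] [/= _ _ Dx Dy] <-].
  apply: (le_trans (ler_normB _ _)).
  by rewrite mulr2n mulrDl mul1r; apply: lerD; apply: fM; exact: cD.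
have Vne n : V n !=set0.
  have [_ [] [_ [t1 S1] _ _] _] := G1; have [_ [] [_ [t2 S2] _ _] _] := G2.
  pose w := nseq (n * N) (ord0 : 'I_3).
  eexists; exists ((w, w), ((t1, t2), (t1, t2))); last reflexivity.
  by split; rewrite /= ?size_nseq.
have step n : sup (V n.+1) <= kappa * sup (V n) + C * (a `^ s) ^+ n.
  apply: ge_sup => // _ [[[w e] [x y]] [/= sw se Dx Dy] <-].
  (* The first letters of a word act last, so the functional equation strips the first block of [N]
     letters and leaves a word of level [n]. *)
  have szT (v : seq 'I_3) : size v = (n.+1 * N)%N -> size (take N v) == N.
    by move=> sv; rewrite size_takel// sv mulSn leq_addr.
  have szD (v : seq 'I_3) : size v = (n.+1 * N)%N -> size (drop N v) = (n * N)%N.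
    by move=> sv; rewrite size_drop sv mulSn addKn.
  pose w1 : word N := Tuple (szT _ sw); pose e1 : word N := Tuple (szT _ se).
  pose X := cell_map p q (drop N w) (drop N e) x.
  pose Y := cell_map p q (drop N w) (drop N e) y.
  have cE u : cell_map p q w e u =
      cell_map p q w1 e1 (cell_map p q (drop N w) (drop N e) u).
    by rewrite /cell_map /= -!word_map_cat !cat_take_drop.
  have DX : D X by exact: cD.
  have DY : D Y by exact: cD.
  rewrite !cE -/X -/Y !(fif_equation _ _ hf)//.
  (* [X] and [Y] lie in one level-[n] cell, whose diameter is at most [a ^+ n]. *)
  have XY : edist4 X Y `^ s <= (a `^ s) ^+ n.
    rewrite -powRX ?(ltW (proj1 (andP a01)))//.
    rewrite ge0_ler_powR ?nnegrE ?sqrtr_ge0 ?exprn_ge0 ?invr_ge0//.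
    rewrite edist4_cell_map; last by rewrite !szD.
    rewrite szD// mulnC exprM -[leRHS]mulr1.
    by rewrite ler_wpM2l ?exprn_ge0 ?invr_ge0// diam.
  have fXY : `|f X - f Y| <= sup (V n).
    apply: ub_le_sup; first by exists (2 * M); exact: V2M.
    by exists ((drop N w, drop N e), (x, y)) => //; split; rewrite /= ?szD.
  (* The first summand yields [kappa] times the level-[n] oscillation, the others the forcing
     term. *)
  have -> : alpha w1 e1 X * f X + h w1 e1 X - (alpha w1 e1 Y * f Y + h w1 e1 Y)
    = alpha w1 e1 X * (f X - f Y)
      + ((h w1 e1 X - h w1 e1 Y) + (alpha w1 e1 X - alpha w1 e1 Y) * f Y).
    by ring.
  apply: (le_trans (ler_normD _ _)); apply: lerD.
    by rewrite normrM ler_pM// ak.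
  apply: (@le_trans _ _ (C * edist4 X Y `^ s)); last by rewrite ler_wpM2l.
  apply: (le_trans (ler_normD _ _)); rewrite [C * _]mulrDl; apply: lerD; first exact: hK.
  by rewrite normrM mulrAC ler_pM// ?aK ?fM.
have rho : 0 <= a `^ s <= a `^ beta by rewrite powR_ge0 /= ger_powR.
have E0 : sup (V 0%N) <= 2 * M by apply: ge_sup.
have kr' : 0 <= kappa <= a `^ beta by rewrite kappa0.
have M20 : 0 <= 2 * M by rewrite mulr_ge0.
have H := geometric_recursion M20 C0 kr' rho kN E0 step.
exists (2 * M + C / `|kappa - a `^ s|); first by rewrite addr_ge0 ?mulr_ge0 ?invr_ge0.
move=> n w e x y sw se Dx Dy; apply: le_trans (H n).
apply: ub_le_sup; first by exists (2 * M); exact: V2M.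
by exists ((w, e), (x, y)).
Qed.

(** * From cell oscillation to Hölder continuity *)

Lemma holder_of_level_oscillation (R : realType) (N : nat) p q
    (SG1 SG2 : set 'rV[R]_2) (f : 'rV[R]_2 * 'rV[R]_2 -> R) (beta B : R) :
  (0 < N)%N -> is_gasket p SG1 -> is_gasket q SG2 ->
  (forall x y, (SG1 `*` SG2) x -> (SG1 `*` SG2) y -> edist4 x y <= 1) ->
  0 <= beta -> 0 <= B ->
  (forall n w e x y, size w = (n * N)%N -> size e = (n * N)%N ->
    (SG1 `*` SG2) x -> (SG1 `*` SG2) y ->
    `|f (cell_map p q w e x) - f (cell_map p q w e y)|
      <= B * ((2^-1 ^+ N) `^ beta) ^+ n) ->
  holder (SG1 `*` SG2) f beta.
Proof.
move=> N0 G1 G2 diam beta0 B0 osc; set a : R := 2^-1 ^+ N in osc *.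
have a0 : 0 < a by rewrite exprn_gt0 ?invr_gt0.
have [[_ [] [_ [t1 S1] _ _] _] [_ [] [_ [t2 S2] _ _] _]] := (G1, G2).
have diam1 x y : SG1 x -> SG1 y -> edist2 x y <= 1.
  move=> Sx Sy; have [+ _] := edist2_le_edist4 (x, t2) (y, t2).
  by move/le_trans; apply; apply: diam.
have diam2 x y : SG2 x -> SG2 y -> edist2 x y <= 1.
  move=> Sx Sy; have [_] := edist2_le_edist4 (t1, x) (t1, y).
  by move/le_trans; apply; apply: diam.
have [L1 L10 touch1] := close_touching G1 diam1.
have [L2 L20 touch2] := close_touching G2 diam2.
pose L := L1 + L2; have L0 : 0 < L by rewrite addr_gt0.
(* The factor 2 counts the two touching cells; the power comes from [a ^+ n <= (L / a) * d] at the
   level [n] chosen below. *)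
exists (2 * B * (L / a) `^ beta) => x y Dx Dy xy.
have d0 := edist4_gt0 xy; set d := edist4 x y in d0 *.
(* The least such [n] is the finest level whose cells are still large compared with the distance.
   Existence follows from [a ^+ n.+1 <= 2^-n], which uses [0 < N]. *)
have exn : exists n, a ^+ n.+1 <= L * d.
  have Ld : 0 < L * d by rewrite mulr_gt0.
  have [n _ /(_ n (leqnn n)) /= Hn] := near_infty_natSinv_expn_lt (PosNum Ld).
  exists n; apply: le_trans (ltW Hn); rewrite /a -exprM div1r -exprVn.
  rewrite ler_wiXn2l ?invr_ge0 ?invf_le1 ?ler1n//.
  by rewrite (leq_trans (leqnSn n))// leq_pmull.
case: (ex_minnP exn) => n Hn minn.
(* Minimality at [n.-1] gives this only for positive [n]; level 0 is covered by the guard in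
   [close_touching]. *)
have close : (0 < n * N)%N -> L * d < 2^-1 ^+ (n * N).
  rewrite muln_gt0 N0 andbT mulnC exprM -/a => n0; rewrite ltNge; apply/negP.
  by rewrite -(prednK n0) => /minn; rewrite leqNgt ltn_predL n0.
have [de1 de2] := edist2_le_edist4 x y.
have {}touch1 : touching p SG1 (n * N) x.1 y.1.
  apply: touch1; [by case: Dx|by case: Dy|apply/implyP => /close].
  by apply: le_lt_trans; rewrite ler_pM ?sqrtr_ge0 ?(ltW L10)// lerDl ltW.
have {}touch2 : touching q SG2 (n * N) x.2 y.2.
  apply: touch2; [by case: Dx|by case: Dy|apply/implyP => /close].
  by apply: le_lt_trans; rewrite ler_pM ?sqrtr_ge0 ?(ltW L20)// lerDr ltW.
have [w [w' [u [u' [v [v' [[sw sw'] [Su Su' Sv Sv'] xu yu vv]]]]]]] := touch1.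
have [e [e' [s [s' [c [c' [[se se'] [Ss Ss' Sc Sc'] xs ys cc]]]]]]] := touch2.
have xE : x = cell_map p q w e (u, s) by rewrite /cell_map/= -xu -xs; case: (x).
have yE : y = cell_map p q w' e' (u', s') by rewrite /cell_map/= -yu -ys; case: (y).
(* The common points found in the two factors combine into a common point of the product cells,
   through which the increment of [f] is split. *)
have pE : cell_map p q w e (v, c) = cell_map p q w' e' (v', c').
  by rewrite /cell_map /= vv cc.
apply: (@le_trans _ _ (2 * B * (a `^ beta) ^+ n)).
  rewrite -(subrKA (f (cell_map p q w e (v, c)))).
  apply: (le_trans (ler_normD _ _)); rewrite mulr2n !mulrDl mul1r; apply: lerD.
    by rewrite xE; exact: osc.
  by rewrite pE yE; exact: osc.
have [a_ge0 L_ge0 d_ge0] : [/\ 0 <= a, 0 <= L & 0 <= d] by split; exact: ltW.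
rewrite -[leRHS]mulrA ler_wpM2l ?mulr_ge0// -powRX// -powRM ?divr_ge0//.
rewrite ge0_ler_powR ?nnegrE ?exprn_ge0 ?mulr_ge0 ?invr_ge0//.
by rewrite mulrAC ler_pdivlMr// -exprSr.
Qed.

(** * The three cases of the exponent *)

Lemma ltr_powR_exponent (R : realType) (a b c : R) : 0 < a < 1 -> b < c ->
  a `^ c < a `^ b.
Proof.
move=> a01 bc; have /andP[a0 _] := a01.
by rewrite -ltr_ln ?posrE ?powR_gt0// !ln_powR ltr_nM2r// ln_lt0.
Qed.

(** Continuity on a compact set bounds the values, which makes the [sup] in [supnorm] an actual
    upper bound. *)
Lemma max_supnorm_ge (R : realType) (T : topologicalType) (N : nat) (D : set T)
    (alpha : word N -> word N -> T -> R) w e x : compact D ->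
  {within D, continuous (alpha w e)} -> D x ->
  `|alpha w e x| <= max_supnorm D alpha.
Proof.
move=> cD cont Dx; have [M _ HM] := compact_continuous_bounded cD cont.
apply: le_trans (le_bigmax 0 (fun we => supnorm D (alpha we.1 we.2)) (w, e)).
apply: ub_le_sup; last by exists x.
by exists M => _ [y Dy <-]; exact: HM.
Qed.

Theorem theorem3p3 (R : realType) (N : nat) (hN : (1 <= N)%N)
  (p q : 'I_3 -> 'rV[R]_2) (SG1 SG2 : set 'rV[R]_2)
  (hSG1 : is_gasket p SG1) (hSG2 : is_gasket q SG2)
  (hdiam : forall x y, (SG1 `*` SG2) x -> (SG1 `*` SG2) y -> edist4 x y <= 1)
  (z : 'rV[R]_2 * 'rV[R]_2 -> R)
  (hz : forall y, vertices p q N y ->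
     (range p `*` SG2 `|` SG1 `*` range q) y -> z y = 0)
  (alpha h : word N -> word N -> 'rV[R]_2 * 'rV[R]_2 -> R)
  (halphac : forall w e, {within SG1 `*` SG2, continuous (alpha w e)})
  (halpha1 : forall w e, supnorm (SG1 `*` SG2) (alpha w e) < 1)
  (hM1 : matching1 p SG2 h) (hM2 : matching2 q SG1 h) (hM3 : matching3 p q h)
  (f : 'rV[R]_2 * 'rV[R]_2 -> R)
  (hf : is_fif p q SG1 SG2 z alpha h f)
  (Kh Ka sh : R) (sa : word N -> word N -> R)
  (hsh : 0 < sh <= 1) (hsa : forall w e, 0 < sa w e <= 1)
  (hhh : forall w e, holder_with (SG1 `*` SG2) (h w e) Kh sh)
  (hha : forall w e, holder_with (SG1 `*` SG2) (alpha w e) Ka (sa w e)) :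
  let a : R := 1 / 2 ^+ N in
  let nalpha := max_supnorm (SG1 `*` SG2) alpha in
  let s := Num.min sh (min_exponent sa) in
  [/\ nalpha < a -> holder (SG1 `*` SG2) f s,
      nalpha = a ->
        exists mu : R, [/\ 0 < mu < 1, 0 < s - mu
          & holder (SG1 `*` SG2) f (s - mu)]
    & a < nalpha ->
        s - 1 + ln nalpha / ln a < 1 /\
        forall lambda : R, 0 < lambda <= s - 1 + ln nalpha / ln a ->
          holder (SG1 `*` SG2) f lambda].
Proof.
move=> a nalpha s.
have aE : a = 2^-1 ^+ N by rewrite /a div1r exprVn.
have a01 : 0 < a < 1.
  rewrite aE exprn_gt0 ?invr_gt0//= exprn_ilt1 ?invr_ge0// -?lt0n//.
  by rewrite invf_lt1// ltr1n.
have [a0 a1] := andP a01.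
have a01' : 0 < a <= 1 by rewrite a0 ltW.
have aX1 : a = a `^ 1 by rewrite powRr1// ltW.
have cD : compact (SG1 `*` SG2).
  by apply: compact_setX; [case: hSG1 => _ [] [] | case: hSG2 => _ [] []].
have s_le_sa w e : s <= sa w e.
  apply: (@le_trans _ _ (min_exponent sa)); first by rewrite ge_min lexx orbT.
  exact: (bigmin_le 1 (w, e) (fun we => sa we.1 we.2)).
have s_le_sh : s <= sh by rewrite ge_min lexx.
have s1 : s <= 1 by apply: le_trans s_le_sh _; case/andP: hsh.
have s0 : 0 < s.
  rewrite lt_min (proj1 (andP hsh)) /=; apply: lt_bigmin => // we _.
  by case/andP: (hsa we.1 we.2).
have main kappa beta : nalpha <= kappa -> kappa <= a `^ beta -> kappa != a `^ s ->
    0 <= beta -> beta <= s -> holder (SG1 `*` SG2) f beta.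
  move=> nk kr ks b0 bs.
  have [|||||||B B0 osc] := fif_level_oscillation (Kh := Kh) (Ka := Ka)
    (s := s) (kappa := kappa) (beta := beta) hSG1 hSG2 hdiam hf.
  - exact: ltW.
  - by move=> w e x Dx; apply: le_trans nk; exact: max_supnorm_ge.
  - by move=> w e x y; apply: (holder_weaken hdiam (hhh w e)).
  - by move=> w e x y; apply: (holder_weaken hdiam (hha w e)).
  - by [].
  - by rewrite -aE.
  - by rewrite -aE.
  exact: (holder_of_level_oscillation hN hSG1 hSG2 hdiam b0 B0 osc).
split => [na|na|na].
- have na_lt : nalpha < a `^ s.
    by apply: (lt_le_trans na); rewrite {1}aX1 ger_powR.
  by apply: (main nalpha); rewrite ?(lt_eqF na_lt)// ltW.
- have lt_s : s / 2 < s by lra.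
  exists (s / 2); split; [by lra..|].
  rewrite (_ : s - s / 2 = s / 2); last by lra.
  apply: (main (a `^ (s / 2))); rewrite ?(gt_eqF (ltr_powR_exponent a01 lt_s))//.
  + by rewrite na {1}aX1 ger_powR//; lra.
  + by lra.
  + by lra.
- have na0 : 0 < nalpha := lt_trans a0 na.
  have lna : ln a < 0 by exact: ln_lt0.
  (* [tau] is the exponent with [nalpha = a]^ tau[. From]tau < 1[and]s <=
     1[, every admissible]lambda[is below]s[and at most]tau[, so]a [^ lambda] is at least [nalpha]
     and is not resonant. *)
  pose tau := ln nalpha / ln a; rewrite -/tau.
  have tau1 : tau < 1 by rewrite ltr_ndivrMr// mul1r ltr_ln ?posrE.
  have nE : nalpha = a `^ tau.
    by apply: ln_inj; rewrite ?posrE ?powR_gt0// ln_powR divfK// lt_eqF.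
  split=> [|lambda /andP[l0 lt]]; first by lra.
  have ls : lambda < s by lra.
  apply: (main (a `^ lambda));
    rewrite ?(gt_eqF (ltr_powR_exponent a01 ls)) ?(ltW ls) ?(ltW l0)//.
  by rewrite nE ger_powR//; lra.
Qed.
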